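(* Let $e_s\in\mathbb{R}^3$ be a unit vector with all components nonnegative. Let $\mathcal{T}$ be a time interval and let $r(t)\in\mathbb{R}^3$, $t\in\mathcal{T}$, be the position of the chaser spacecraft. Assume that $\rho^-=\inf_{t\in\mathcal{T}}\|r(t)\|_2>0$ and that, for each $i\in\{1,2,3\}$, $\rho^+_{(i)}=\sup_{t\in\mathcal{T}}|r_{(i)}(t)|$ is finite, where $r_{(i)}$ is the $i$th component of $r$; write $\rho^+=(\rho^+_{(1)},\rho^+_{(2)},\rho^+_{(3)})^T$. Then for every $t\in\mathcal{T}$ the angle $\theta=\angle(e_s,r(t))$ satisfies $$|\cos\theta|\le\min\left\{1,\frac{e_s^T\rho^+}{\rho^-}\right\}.$$
   Context: $\|\cdot\|_2$ is the Euclidean norm, and the angle $\theta$ between $e_s$ and $r$ is given by $\cos\theta=e_s^Tr/(\|e_s\|_2\|r\|_2)$. The statement makes no assumption on the dynamics generating the trajectory $r(\cdot)$. *)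

(* Defs.v *)
From HB Require Import structures.
From mathcomp Require Import all_boot all_order all_algebra.
From mathcomp Require Import all_classical all_reals all_analysis.

Set Implicit Arguments.
Unset Strict Implicit.
Unset Printing Implicit Defensive.

Import Order.TTheory GRing.Theory Num.Theory.
Import numFieldNormedType.Exports.

Local Open Scope classical_set_scope.
Local Open Scope ring_scope.

Definition dotp (R : realType) (n : nat) (u v : 'cV[R]_n) : R :=
  (u^T *m v) 0 0.

(* The norm `|v| that the library puts on matrices is the max norm, hence a
   separate definition of the Euclidean one. *)
Definition norm2 (R : realType) (n : nat) (v : 'cV[R]_n) : R :=
  Num.sqrt (dotp v v).

(* The angle lies in [0, pi]; it is meaningful only for nonzero vectors. *)
Definition angle (R : realType) (n : nat) (u v : 'cV[R]_n) : R :=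
  acos (dotp u v / (norm2 u * norm2 v)).

Definition rho_minus (R : realType) (n : nat) (T : set R) (r : R -> 'cV[R]_n)
    : R :=
  inf [set norm2 (r t) | t in T].

(* An entry is the actual supremum only when the set below is bounded above
   (sup is 0 otherwise). *)
Definition rho_plus (R : realType) (n : nat) (T : set R) (r : R -> 'cV[R]_n)
    : 'cV[R]_n :=
  \col_i sup [set `|r t i 0| | t in T].

(* Main.v *)
Require Import Defs.
From HB Require Import structures.
From mathcomp Require Import all_boot all_order all_algebra.
From mathcomp Require Import all_classical all_reals all_analysis.
From mathcomp Require Import ring.

Import Order.TTheory GRing.Theory Num.Theory.
Import numFieldNormedType.Exports.

Local Open Scope classical_set_scope.
Local Open Scope ring_scope.

(** As [e_s] is a unit vector, the cosine is the dot product of [e_s] and [r t] divided by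
    [norm2 (r t)]. Its numerator is bounded componentwise by the suprema ([normr_dotp_le_rho_plus]),
    its denominator from below by the infimum ([rho_minus_le]). Cauchy-Schwarz enters because the
    angle is an [acos]: it makes the quotient a legitimate cosine ([cos_angle]). *)

Lemma dotpE (R : realType) (n : nat) (u v : 'cV[R]_n) :
  dotp u v = \sum_i u i 0 * v i 0.
Proof. by rewrite /dotp mxE; apply: eq_bigr => i _; rewrite mxE. Qed.

Lemma dotp_ge0 (R : realType) (n : nat) (v : 'cV[R]_n) : 0 <= dotp v v.
Proof. by rewrite dotpE sumr_ge0 // => i _; rewrite -expr2 sqr_ge0. Qed.

Lemma dotp_eq0 (R : realType) (n : nat) (v : 'cV[R]_n) :
  dotp v v = 0 -> v = 0.
Proof.
rewrite dotpE => /psumr_eq0P v0; apply/colP => i; rewrite mxE.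
by apply/eqP; rewrite -sqrf_eq0 expr2 v0 // => j _; rewrite -expr2 sqr_ge0.
Qed.

Lemma sqr_norm2 (R : realType) (n : nat) (v : 'cV[R]_n) :
  norm2 v ^+ 2 = dotp v v.
Proof. exact/sqr_sqrtr/dotp_ge0. Qed.

Lemma cauchy_schwarz (R : realType) (n : nat) (u v : 'cV[R]_n) :
  `|dotp u v| <= norm2 u * norm2 v.
Proof.
rewrite -ler_sqr ?nnegrE ?mulr_ge0 ?sqrtr_ge0 // real_normK ?num_real //.
rewrite exprMn !sqr_norm2.
(* If [dotp v v] vanishes then so does [v], and both sides are 0; otherwise it may be divided
   out. *)
have [v0|v0] := eqVneq (dotp v v) 0.
  by rewrite v0 (dotp_eq0 _ _ _ v0) /dotp mulmx0 mxE expr0n mulr0.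
have vv_gt0 : 0 < dotp v v by rewrite lt_def v0 dotp_ge0.
(* Expand [0 <= |<v,v> u - <u,v> v|^2]; dividing by [<v,v>] gives the claim. *)
rewrite -subr_ge0 -(pmulr_rge0 _ vv_gt0).
have := dotp_ge0 _ _ (dotp v v *: u - dotp u v *: v); congr (0 <= _).
rewrite [LHS]dotpE; under eq_bigr do rewrite !mxE.
(* The expanded square is grouped so that each of the three sums is a scalar times a dot product. *)
transitivity (\sum_i (dotp v v ^+ 2 * (u i 0 * u i 0)
    + (- (2 * dotp v v * dotp u v) * (u i 0 * v i 0)
    + dotp u v ^+ 2 * (v i 0 * v i 0)) : R)).
  by apply: eq_bigr => i _; ring.
by rewrite !big_split /= -!mulr_sumr -!dotpE; ring.
Qed.

(** [acos] inverts [cos] only on [-1, 1]; Cauchy-Schwarz puts the quotient there. *)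
Lemma cos_angle (R : realType) (n : nat) (u v : 'cV[R]_n) :
  0 < norm2 u -> 0 < norm2 v ->
  cos (angle u v) = dotp u v / (norm2 u * norm2 v).
Proof.
move=> u0 v0; apply: acosK; rewrite in_itv /= -ler_norml normf_div.
have uv0 : 0 < norm2 u * norm2 v by rewrite mulr_gt0.
by rewrite (gtr0_norm uv0) ler_pdivrMr // mul1r cauchy_schwarz.
Qed.

Lemma rho_minus_le (R : realType) (n : nat) (T : set R) (r : R -> 'cV[R]_n)
    (t : R) : T t -> rho_minus T r <= norm2 (r t).
Proof.
move=> Tt; apply: ge_inf; last by exists t.
by exists 0 => _ [s _ <-]; exact: sqrtr_ge0.
Qed.

(** Triangle inequality, then a termwise comparison: the weights [u i 0] are their own absolute
    values, and boundedness makes each [sup] a genuine upper bound. *)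
Lemma normr_dotp_le_rho_plus (R : realType) (n : nat) (T : set R)
    (r : R -> 'cV[R]_n) (u : 'cV[R]_n) (t : R) :
  (forall i, 0 <= u i 0) ->
  (forall i, has_ubound [set `|r s i 0| | s in T]) ->
  T t -> `|dotp u (r t)| <= dotp u (rho_plus T r).
Proof.
move=> u0 r_ub Tt; rewrite !dotpE (le_trans (ler_norm_sum _ _ _)) //.
apply: ler_sum => i _; rewrite normrM ger0_norm // mxE ler_wpM2l //.
by apply: ub_le_sup => //; exists t.
Qed.

Theorem theorem3 (R : realType) (e_s : 'cV[R]_3)
    (e_s_unit : norm2 e_s = 1)
    (e_s_ge0 : forall i : 'I_3, 0 <= e_s i 0)
    (T : set R) (T_itv : is_interval T)
    (r : R -> 'cV[R]_3)
    (rho_minus_gt0 : 0 < rho_minus T r)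
    (rho_plus_fin : forall i : 'I_3, has_ubound [set `|r t i 0| | t in T]) :
  forall t : R, T t ->
    `|cos (angle e_s (r t))|
      <= Num.min 1 (dotp e_s (rho_plus T r) / rho_minus T r).
Proof.
move=> t Tt.
have rt_ge := rho_minus_le _ _ _ r _ Tt.
(* Hence [r t] is nonzero and its angle with [e_s] is meaningful. *)
have rt_gt0 := lt_le_trans rho_minus_gt0 rt_ge.
rewrite le_min; apply/andP; split.
  by rewrite ler_norml cos_geN1 cos_le1.
rewrite cos_angle ?e_s_unit // mul1r normf_div (gtr0_norm rt_gt0).
(* Numerators and inverted denominators are compared separately; inversion reverses [rt_ge]. *)
rewrite ler_pM ?invr_ge0 ?(ltW rt_gt0) ?lef_pV2 //.
exact: normr_dotp_le_rho_plus.
Qed.
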